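(* Let $\mathcal{P}_1$ be the hybrid path planning and energy management problem on the sampled graph $G_s(V_s,E_s)$, and let $\mathcal{P}_3$ be its relaxation obtained by partitioning the admissible states of charge at each vertex into finitely many sub-intervals, both as defined in the context. Then the optimal value of $\mathcal{P}_3$ is a lower bound for the optimal value of $\mathcal{P}_1$, i.e. $$\operatorname{opt}(\mathcal{P}_3)\;\le\;\operatorname{opt}(\mathcal{P}_1).$$
   Context: **Graph.** $G_s(V_s,E_s)$ is a finite graph whose vertices are points of the plane, including a start vertex $v_s$ and a goal vertex $v_t\neq v_s$. (In the application, the other vertices are sample points on the boundaries of given planar regions called quiet zones, and $(v_i,v_j)$ is an edge if the straight segment joining $v_i$ and $v_j$ meets no other quiet zone; edges between vertices of the same quiet zone are included.) An edge $(v_i,v_j)\in E_s$ may be travelled in either direction, along the straight segment from $v_i$ to $v_j$, whose length is $d_{ij}$. A subset $E_Q\subseteq E_s$ consists of the edges lying inside quiet zones. Let $I=\{1,\dots,|V_s|\}$ be the index set of the vertices (the symbols $s,t$ also denote the indices of $v_s,v_t$). **Battery.** Fixed constants: $\alpha,\beta>0$ (discharge and recharge rates per unit distance), $c_f>0$ (fuel cost per unit distance travelled in gasoline mode), $q_{\min}<q_{\max}$ (battery limits), $q_{init}\in[q_{\min},q_{\max}]$ (prescribed charge at $v_s$), and $q_{goal}\in[q_{\min},q_{\max})$ (minimum charge required at $v_t$). The vehicle is at each moment in electric mode or gasoline mode and may switch instantaneously. Along the path, as a function of travelled distance $\sigma$, the state of charge $q(\sigma)$ is continuous and satisfies $q'(\sigma)=-\alpha$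 in electric mode, $q'(\sigma)=\beta$ in gasoline mode, and $q_{\min}\le q(\sigma)\le q_{\max}$. Edges in $E_Q$ must be travelled entirely in electric mode. **Edge cost.** For $(v_i,v_j)\in E_s$ and $q_i,q_j\in[q_{\min},q_{\max}]$, $c_{ij}(q_i,q_j)\in[0,\infty]$ is the fuel cost of travelling from $v_i$ to $v_j$ with charge $q_i$ at the start and $q_j$ at the end of the edge: it equals $c_f$ times the minimum total length travelled in gasoline mode over all mode schedules (with finitely many switches) on the segment that obey the battery rules above (including the electric-only rule if the edge is in $E_Q$) and take the charge from $q_i$ to $q_j$; it equals $+\infty$ if no such schedule exists. **Paths.** $\mathcal{X}$ is the set of binary matrices $\mathbf{x}=(x_{ij})_{i,j\in I}$ that encode paths in $G_s$ from $v_s$ to $v_t$ (without repeated vertices): $x_{ij}=1$ if the path travels the edge from $v_i$ to $v_j$, and $x_{ij}=0$ otherwise. In the sums below only the terms with $x_{ij}=1$ contribute. **Problem $\mathcal{P}_1$.** $$\min_{\mathbf{x}\in\mathcal{X},\; q_k\in[q_{\min},q_{\max}]\ \forall k\in I}\ \sum_{i,j\in I}x_{ij}\,c_{ij}(q_i,q_j),$$ where the charge at the start vertex is $q_s=q_{init}$ and the charge at the goal vertex satisfies $q_t\ge q_{goal}$. **Partition.** For each $v_k\in V_s\setminus\{v_s,v_t\}$, $Q_l^k=\{[q_{\min},q_1],[q_1,q_2],\dots,[q_{n_l-1},q_{\max}]\}$ is a partition of $[q_{\min},q_{\max}]$ into $n_l$ consecutive sub-intervals; for the goal, $Q_l^t=\{[q_{goal},q_1],\dots,[q_{n_g-1},q_{\max}]\}$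 is a partition of $[q_{goal},q_{\max}]$ into $n_g$ consecutive sub-intervals (with its own breakpoints); for the start, $Q_l^s=\{\{q_{init}\}\}$. The numbers $n_l,n_g\ge 1$ and the breakpoints are arbitrary. For intervals $\bar q_i\in Q_l^i$ and $\bar q_j\in Q_l^j$, define $$c_{ij}(\bar q_i,\bar q_j)=\min_{q_i\in\bar q_i,\ q_j\in\bar q_j}c_{ij}(q_i,q_j)$$ (understood as an infimum in $[0,\infty]$). **Problem $\mathcal{P}_3$.** $$\min_{\mathbf{x}\in\mathcal{X},\;\bar q_k\in Q_l^k\ \forall k\in I}\ \sum_{i,j\in I}x_{ij}\,c_{ij}(\bar q_i,\bar q_j).$$ Thus in $\mathcal{P}_3$ the charges with which the vehicle arrives at and leaves a vertex need not coincide, but must lie in the same chosen sub-interval. $\operatorname{opt}(\cdot)$ denotes the optimal value (infimum of the objective in $[0,\infty]$, equal to $+\infty$ if there is no feasible solution of finite cost). *)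

(* Defs.v *)
From mathcomp Require Import all_boot all_order all_algebra.
From mathcomp Require Import all_classical all_reals all_analysis.

Set Implicit Arguments.
Unset Strict Implicit.
Unset Printing Implicit Defensive.

Import Order.TTheory GRing.Theory Num.Theory.
Import numFieldNormedType.Exports.
Local Open Scope classical_set_scope.
Local Open Scope ring_scope.

(* The vertices are identified with their indices. Undirected edges are encoded
   by symmetric relations. *)
Record planar_graph (R : realType) := PlanarGraph {
  nV : nat;
  pos : 'I_nV -> R * R;
  edge : rel 'I_nV;
  quiet_edge : rel 'I_nV;
  vs : 'I_nV;
  vt : 'I_nV;
  pos_inj : injective pos;
  edge_sym : symmetric edge;
  quiet_edge_sym : symmetric quiet_edge;
  quiet_edge_sub : subrel quiet_edge edge;
  vt_neq_vs : vt != vs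
}.

Record battery (R : realType) := Battery {
  alpha : R;
  beta : R;
  c_f : R;
  q_min : R;
  q_max : R;
  q_init : R;
  q_goal : R;
  alpha_gt0 : 0 < alpha;
  beta_gt0 : 0 < beta;
  c_f_gt0 : 0 < c_f;
  q_min_lt_max : q_min < q_max;
  q_init_bounds : q_min <= q_init <= q_max;
  q_goal_bounds : q_min <= q_goal < q_max
}.

Inductive mode := Electric | Gasoline.

Definition is_gasoline (m : mode) : bool :=
  if m is Gasoline then true else false.

Section Definitions.
Variable R : realType.

(* [:: (m_1, l_1); ...; (m_n, l_n)]: travel distance l_1 in mode m_1, then l_2
   in mode m_2, and so on; consecutive modes may coincide. *)
Definition schedule := seq (mode * R).

Definition travelled (w : schedule) (k : nat) : R :=
  \sum_(p <- take k w) p.2.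

Definition schedule_length (w : schedule) : R := \sum_(p <- w) p.2.

Definition gasoline_length (w : schedule) : R :=
  \sum_(p <- w | is_gasoline p.1) p.2.

Section Problem.
Variables (G : planar_graph R) (B : battery R).
Let I := 'I_(nV G).

Definition charge_rate (m : mode) : R :=
  match m with Electric => - alpha B | Gasoline => beta B end.

(* At the switching points the charge is only required to be continuous. *)
Definition charge_profile (w : schedule) (q : R -> R) : Prop :=
  [/\ {within `[0, schedule_length w], continuous q},
      forall (k : nat) (sigma : R), (k < size w)%N ->
        travelled w k < sigma < travelled w k.+1 ->
        is_derive sigma 1 q (charge_rate (nth (Electric, 0) w k).1) &
      forall sigma : R, 0 <= sigma <= schedule_length w ->
        q_min B <= q sigma <= q_max B].

(* The Euclidean distance, as the library norm on R * R is the max norm. *)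
Definition distance (i j : I) : R :=
  Num.sqrt (((pos i).1 - (pos j).1) ^+ 2 + ((pos i).2 - (pos j).2) ^+ 2).

Definition admissible_schedule (i j : I) (qi qj : R) (w : schedule) : Prop :=
  [/\ all (fun p : mode * R => 0 < p.2) w,
      schedule_length w = distance i j,
      quiet_edge i j -> all (fun p => ~~ is_gasoline p.1) w &
      exists q : R -> R,
        [/\ charge_profile w q, q 0 = qi & q (schedule_length w) = qj]].

(* The infimum over no schedule is +oo. Otherwise it is a minimum, since the
   length of the edge and qj - qi determine the gasoline length. *)
Definition edge_cost (i j : I) (qi qj : R) : \bar R :=
  ereal_inf [set (c_f B * gasoline_length w)%:E
            | w in admissible_schedule i j qi qj].

(* zip (vs G :: p) p lists the pairs of consecutive vertices of the path
   vs G :: p. *)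
Definition path_matrix : set 'M[bool]_(nV G) :=
  [set x | exists p : seq I,
     [/\ path (@edge R G) (vs G) p, last (vs G) p = vt G, uniq (vs G :: p) &
         forall i j, x i j = ((i, j) \in zip (vs G :: p) p)]].

Definition P1_feasible (x : 'M[bool]_(nV G)) (q : I -> R) : Prop :=
  [/\ path_matrix x,
      forall k, q_min B <= q k <= q_max B,
      q (vs G) = q_init B &
      q_goal B <= q (vt G)].

Definition P1_objective (x : 'M[bool]_(nV G)) (q : I -> R) : \bar R :=
  (\sum_i \sum_(j | x i j) edge_cost i j (q i) (q j))%E.

Definition opt_P1 : \bar R :=
  ereal_inf [set P1_objective xq.1 xq.2
            | xq in [set xq | P1_feasible xq.1 xq.2]].

Definition lower_charge (k : I) : R :=
  if k == vt G then q_goal B else q_min B.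

(* bp k lists the interior breakpoints at vertex k, so that the partition has
   (size (bp k)).+1 sub-intervals. *)
Definition breakpoints (bp : I -> seq R) : Prop :=
  forall k, k != vs G ->
    sorted <%R (lower_charge k :: rcons (bp k) (q_max B)).

Definition partition_at (bp : I -> seq R) (k : I) : seq (interval R) :=
  if k == vs G then [:: `[q_init B, q_init B]]
  else [seq `[ab.1, ab.2] |
         ab <- zip (lower_charge k :: bp k) (rcons (bp k) (q_max B))].

Definition interval_cost (i j : I) (J K : interval R) : \bar R :=
  ereal_inf [set edge_cost i j qi qj | qi in [set` J] & qj in [set` K]].

Definition P3_feasible (bp : I -> seq R) (x : 'M[bool]_(nV G))
    (J : I -> interval R) : Prop :=
  path_matrix x /\ forall k, J k \in partition_at bp k.

Definition P3_objective (x : 'M[bool]_(nV G)) (J : I -> interval R) : \bar R :=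
  (\sum_i \sum_(j | x i j) interval_cost i j (J i) (J j))%E.

Definition opt_P3 (bp : I -> seq R) : \bar R :=
  ereal_inf [set P3_objective xJ.1 xJ.2
            | xJ in [set xJ | P3_feasible bp xJ.1 xJ.2]].

End Problem.
End Definitions.

Arguments breakpoints {R} G B bp.
Arguments opt_P3 {R} G B bp.

(* Main.v *)
(* Given a feasible point (x, q) of P1, choose at each vertex k a sub-interval
   of the partition containing q k. The same path with these sub-intervals is
   feasible for P3, and each edge costs at most as much as before, since its
   relaxed cost is an infimum over pairs of charges including (q i, q j). *)
Require Import Defs.
From mathcomp Require Import all_boot all_order all_algebra.
From mathcomp Require Import all_classical all_reals all_analysis.

Set Implicit Arguments.
Unset Strict Implicit.
Unset Printing Implicit Defensive.

Import Order.TTheory GRing.Theory Num.Theory.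

Local Open Scope ereal_scope.

(** Induction on [s]: either [y] is at most the first breakpoint [c] and [(a, c)] works, or [c < y]
    and the search goes on from [c]; with no breakpoint left, the pair is [(a, b)]. *)
Lemma consecutive_pairs_cover (d : Order.disp_t) (T : orderType d)
    (s : seq T) (a b y : T) :
  (a <= y <= b)%O ->
  exists2 ab, ab \in zip (a :: s) (rcons s b) & (ab.1 <= y <= ab.2)%O.
Proof.
elim: s a => [|c s IHs] a /andP[ay yb].
  by exists (a, b); rewrite ?mem_head //= ay yb.
have [yc|cy] := leP y c.
  by exists (a, c); rewrite ?mem_head //= ay yc.
have [|ab ab_in y_ab] := IHs c; first by rewrite (ltW cy) yb.
by exists ab => //; rewrite /= inE ab_in orbT.
Qed.

Lemma partition_at_cover (R : realType) (G : planar_graph R) (B : battery R)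
    (bp : 'I_(nV G) -> seq R) (x : 'M[bool]_(nV G)) (q : 'I_(nV G) -> R)
    (k : 'I_(nV G)) :
  P1_feasible B x q ->
  exists J, J \in partition_at B bp k /\ q k \in J.
Proof.
case=> _ q_bounds q_start q_end; rewrite /partition_at.
case: eqP => [->|_].
  exists `[q_init B, q_init B]%R; split; first exact: mem_head.
  by rewrite q_start in_itv /= lexx.
(* The partition at the goal starts at [q_goal B], so there the lower bound comes from the
   constraint on the final charge. *)
have q_lower : (lower_charge B k <= q k <= q_max B)%R.
  rewrite /lower_charge; case: eqP => [kt|_]; last exact: q_bounds.
  by have /andP[_ ->] := q_bounds k; rewrite kt q_end.
have [ab ab_in q_ab] := consecutive_pairs_cover (bp k) q_lower.
exists `[ab.1, ab.2]%R; split; last by rewrite in_itv.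
by apply/mapP; exists ab.
Qed.

Lemma interval_cost_le (R : realType) (G : planar_graph R) (B : battery R)
    (i j : 'I_(nV G)) (J K : interval R) (qi qj : R) :
  qi \in J -> qj \in K -> interval_cost B i j J K <= edge_cost B i j qi qj.
Proof. by move=> qiJ qjK; apply: ereal_inf_lbound; exists qi => //; exists qj. Qed.

Theorem theorem1 (R : realType) (G : planar_graph R) (B : battery R)
    (bp : 'I_(nV G) -> seq R) (hbp : breakpoints G B bp) :
  opt_P3 G B bp <= opt_P1 G B.
Proof.
apply: le_ereal_inf_tmp => _ [[x q] /= feas <-].
have [J J_q] := choice (fun k => partition_at_cover bp k feas).
apply: (@le_trans _ _ (P3_objective B x J)).
  apply: ereal_inf_lbound; exists (x, J) => //=.
  by case: feas => x_path _ _ _; split=> // k; have [] := J_q k.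
(* Both objectives range over the edges of the same [x], so they compare term by term. *)
apply: lee_sum => i _; apply: lee_sum => j _.
by apply: interval_cost_le; [have [] := J_q i | have [] := J_q j].
Qed.
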